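(* For each integer $n\geq 3$ there exists an RGD-system $\mathcal{D}_n$ with $\mathrm{ndeg}(\mathcal{D}_n)=n-1$.
   Context: Let $(W,S)$ be a Coxeter system with length function $\ell$. For $s\in S$ put $\alpha_s=\{w\in W\mid\ell(sw)>\ell(w)\}$. A root is a subset $v\alpha_s\subseteq W$ with $v\in W$, $s\in S$; $\Phi$ is the set of roots, $\Phi_+$ the set of roots containing $1_W$, and $-\alpha=W\setminus\alpha$. A pair $\{\alpha,\beta\}$ of roots is prenilpotent if $\alpha\cap\beta\neq\emptyset\neq(-\alpha)\cap(-\beta)$; in this case $[\alpha,\beta]=\{\gamma\in\Phi\mid\alpha\cap\beta\subseteq\gamma,\ (-\alpha)\cap(-\beta)\subseteq-\gamma\}$ and $(\alpha,\beta)=[\alpha,\beta]\setminus\{\alpha,\beta\}$. An RGD-system of type $(W,S)$ is a pair $\mathcal{D}=(G,(U_\alpha)_{\alpha\in\Phi})$ consisting of a group $G$ and a family of subgroups $U_\alpha\leq G$ such that: (RGD0) $U_\alpha\neq\{1\}$ for all $\alpha\in\Phi$; (RGD1) $[U_\alpha,U_\beta]\leq\langle U_\gamma\mid\gamma\in(\alpha,\beta)\rangle$ for every prenilpotent pair $\{\alpha,\beta\}$ with $\alpha\neq\beta$; (RGD2) for every $s\in S$ and $u\in U_{\alpha_s}\setminus\{1\}$ there exist $u',u''\in U_{-\alpha_s}$ such that $u'uu''$ conjugates $U_\beta$ onto $U_{s\beta}$ for every $\beta\in\Phi$; (RGD3) $U_{-\alpha_s}\not\leq\langle U_\alpha\mid\alpha\in\Phi_+\rangle$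 for every $s\in S$; (RGD4) $G$ is generated by the $U_\alpha$, $\alpha\in\Phi$, together with $\bigcap_{\alpha\in\Phi}N_G(U_\alpha)$. An RGD-system is an RGD-system of type $(W,S)$ for some Coxeter system $(W,S)$. For $w\in W$ let $U_w=\langle U_\alpha\mid\alpha\in\Phi_+,\ w\notin\alpha\rangle\leq G$. Then $\mathrm{ndeg}(\mathcal{D})\in\mathbb{N}\cup\{\infty\}$ is the supremum over all $w\in W$ of the nilpotency classes of the groups $U_w$. *)

(* Defs.v *)
From HB Require Import structures.
From mathcomp Require Import all_boot all_order all_algebra.
From mathcomp Require Import boolp classical_sets constructive_ereal.

Set Implicit Arguments.
Unset Strict Implicit.
Unset Printing Implicit Defensive.

Local Open Scope classical_set_scope.
Local Open Scope group_scope.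

Section Subgroups.
Variable G : groupType.
Implicit Types (A B H : set G) (g : G).

Definition is_subgroup H : Prop :=
  [/\ H 1, forall x y, H x -> H y -> H (x * y) & forall x, H x -> H x^-1].

Definition gen_subgroup A : set G := smallest is_subgroup A.

Definition comm_subgroup A B : set G :=
  gen_subgroup [set [~ a, b] | a in A & b in B].

Definition lconj g A : set G := [set g * x * g^-1 | x in A].

Definition normalizer A : set G := [set g | lconj g A = A].

(* The index is shifted: [lower_central H c] is usually written
   gamma_(c+1)(H), so that H is nilpotent of class at most c if and only if
   [lower_central H c] is trivial. *)
Fixpoint lower_central H (c : nat) : set G :=
  if c is c'.+1 then comm_subgroup (lower_central H c') H else H.

(* The least c with [lower_central H c] trivial, and +oo if H is not
   nilpotent. The set of natural numbers extended by infinity is viewed inside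
   [\bar int]. *)
Definition nilpotency_class H : \bar int :=
  infimum (+oo)%E
    [set (c%:Z)%:E%E | c in [set c | lower_central H c = [set 1]]].

End Subgroups.

Definition has_order (G : groupType) (x : G) (m : nat) : Prop :=
  [/\ (0 < m)%N, x ^+ m = 1
    & forall k, (0 < k)%N -> (k < m)%N -> x ^+ k <> 1].

(* The last clause is the universal property of the group presented by the
   generators s in S and the relations (s t)^m(s,t) = 1, for all s, t in S such
   that the order m(s,t) of s t is finite; the case s = t gives s^2 = 1. Only
   the values of f on S matter. *)
Definition is_coxeter (W : groupType) (S : set W) : Prop :=
  [/\ gen_subgroup S = setT,
      forall s, S s -> has_order s 2
    & forall (H : groupType) (f : W -> H),
        (forall s t m, S s -> S t -> has_order (s * t) m ->
           (f s * f t) ^+ m = 1) ->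
        exists phi : {multiplicative W -> H}, forall s, S s -> phi s = f s].

Record coxeterSystem := CoxeterSystem {
  cox_group : groupType;
  cox_gens : set cox_group;
  cox_axiom : is_coxeter cox_gens }.

Section Roots.
Variable C : coxeterSystem.
Local Notation W := (cox_group C).
Local Notation S := (@cox_gens C).
Implicit Types (v w s : W) (alpha beta gamma : set W).

(* Words in S suffice because the elements of S are involutions. *)
Definition cox_length w : nat :=
  infimum 0%N
    [set size ws | ws in [set ws : seq W | [set` ws] `<=` S
                                           /\ \prod_(s <- ws) s = w]].

Definition ltrans v alpha : set W := [set v * x | x in alpha].

Definition simple_root s : set W :=
  [set w | (cox_length w < cox_length (s * w))%N].

Definition cox_roots : set (set W) :=
  [set ltrans v (simple_root s) | v in [set: W] & s in S].

Definition pos_roots : set (set W) := [set alpha | cox_roots alpha /\ alpha 1].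

Definition prenilpotent alpha beta : Prop :=
  alpha `&` beta !=set0 /\ ~` alpha `&` ~` beta !=set0.

Definition root_interval alpha beta : set (set W) :=
  [set gamma | [/\ cox_roots gamma, alpha `&` beta `<=` gamma
                 & ~` alpha `&` ~` beta `<=` ~` gamma]].

Definition open_root_interval alpha beta : set (set W) :=
  root_interval alpha beta `\` [set alpha; beta].

(* [rgd_U alpha] is only meaningful when alpha is a root. *)
Record rgdSystem := RGDSystem {
  rgd_group : groupType;
  rgd_U : set W -> set rgd_group;
  rgd_subgroup : forall alpha, cox_roots alpha -> is_subgroup (rgd_U alpha);
  rgd0 : forall alpha, cox_roots alpha -> rgd_U alpha <> [set 1];
  rgd1 : forall alpha beta, cox_roots alpha -> cox_roots beta ->
    prenilpotent alpha beta -> alpha <> beta ->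
    comm_subgroup (rgd_U alpha) (rgd_U beta) `<=`
      gen_subgroup (\bigcup_(gamma in open_root_interval alpha beta)
                      rgd_U gamma);
  rgd2 : forall s u, S s -> rgd_U (simple_root s) u -> u <> 1 ->
    exists u' u'', [/\ rgd_U (~` simple_root s) u',
      rgd_U (~` simple_root s) u''
      & forall beta, cox_roots beta ->
          lconj (u' * u * u'') (rgd_U beta) = rgd_U (ltrans s beta)];
  rgd3 : forall s, S s ->
    ~ (rgd_U (~` simple_root s) `<=`
         gen_subgroup (\bigcup_(alpha in pos_roots) rgd_U alpha));
  rgd4 : gen_subgroup ((\bigcup_(alpha in cox_roots) rgd_U alpha) `|`
                       (\bigcap_(alpha in cox_roots) normalizer (rgd_U alpha)))
         = setT }.

Definition rgd_Uw (D : rgdSystem) w : set (rgd_group D) :=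
  gen_subgroup (\bigcup_(alpha in [set alpha | pos_roots alpha /\ ~ alpha w])
                  @rgd_U D alpha).

Definition ndeg (D : rgdSystem) : \bar int :=
  supremum (-oo)%E [set nilpotency_class (@rgd_Uw D w) | w in [set: W]].

End Roots.

(* Main.v *)
Require Import Defs.
From HB Require Import structures.
From mathcomp Require Import all_boot all_order all_algebra all_fingroup.
From mathcomp Require Import boolp classical_sets constructive_ereal.
From mathcomp Require Import zify.

(* Take the Coxeter system of type A_(n-1): the symmetric group with its
   adjacent transpositions, whose length function counts inversions. Its roots
   are the sets of permutations [w] with [w a < w b], for [a != b], and the root
   group attached to such a root consists of [1] and the elementary matrix
   [1 + E_ab] over F_2. The positive roots are those with [a < b], so the
   subgroup attached to the order-reversing permutation is the full
   unitriangular group, of class [n - 1], and it contains all the others. *)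

Set Implicit Arguments.
Unset Strict Implicit.
Unset Printing Implicit Defensive.

Import Order.TTheory GRing.Theory.

Local Open Scope classical_set_scope.
Local Open Scope group_scope.

(** * Attained extrema and generated subgroups *)

Lemma infimum_eq d (T : porderType d) (x0 x : T) (A : set T) :
  A x -> lbound A x -> infimum x0 A = x.
Proof.
move=> Ax lbx; rewrite /infimum ifN; last by apply/set0P; exists x.
case: xgetP => [y _ [lby uby]|/(_ x) []]; last by split=> // y; apply.
by apply/le_anti; rewrite lby // uby.
Qed.

Lemma supremum_eq d (T : porderType d) (x0 x : T) (A : set T) :
  A x -> ubound A x -> supremum x0 A = x.
Proof.
move=> Ax ubx; rewrite /supremum ifN; last by apply/set0P; exists x.
case: xgetP => [y _ [uby lby]|/(_ x) []]; last by split=> // y; apply.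
by apply/le_anti; rewrite uby // lby.
Qed.

Section GenSubgroup.
Variable G : groupType.
Implicit Types (A H : set G).

Lemma gen_subgroupP A : is_subgroup (gen_subgroup A).
Proof.
split=> [H [[]]//|x y Ax Ay H HH|x Ax H HH].
  by have [[_ HM _] _] := HH; apply: HM; [exact: Ax|exact: Ay].
by have [[_ _ HV] _] := HH; apply: HV; exact: Ax.
Qed.

Lemma sub_gen_subgroup A : A `<=` gen_subgroup A.
Proof. exact: sub_gen_smallest. Qed.

Lemma gen_subgroup_min A H : is_subgroup H -> A `<=` H -> gen_subgroup A `<=` H.
Proof. exact: smallest_sub. Qed.

End GenSubgroup.

(** * Inversions and adjacent transpositions in the symmetric group *)

Section Symmetric.
Variable m : nat.
Local Notation I := 'I_m.+1.
Local Notation W := {perm I}.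
Implicit Types (w v : W) (i j : 'I_m) (a b : I).

Definition lo i : I := widen_ord (leqnSn m) i.
Definition hi i : I := inord i.+1.
Definition adj i : W := tperm (lo i) (hi i).

Lemma val_hi i : hi i = i.+1 :> nat. Proof. by rewrite inordK // ltnS. Qed.

Lemma lo_lt_hi i : (lo i < hi i)%N. Proof. by rewrite val_hi. Qed.

Lemma lo_neq_hi i : lo i != hi i.
Proof. by rewrite -val_eqE /= neq_ltn lo_lt_hi. Qed.

Lemma val_adj i a :
  adj i a = (if a == i :> nat then i.+1 else if a == i.+1 :> nat then i : nat
             else a) :> nat.
Proof.
rewrite /adj; case: tpermP => [->|->|].
- by rewrite val_hi /= eqxx.
- by rewrite val_hi /= eqxx gtn_eqF.
- move=> /eqP ne_lo /eqP ne_hi; rewrite -val_eqE in ne_lo.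
  by rewrite -val_eqE -[val (hi i)]/(nat_of_ord (hi i)) val_hi in ne_hi;
    rewrite (negPf ne_lo) (negPf ne_hi).
Qed.

Lemma adjK i : adj i * adj i = 1.
Proof. exact: tperm2. Qed.

Lemma adjKl i w : adj i * (adj i * w) = w.
Proof. by rewrite mulgA adjK mul1g. Qed.

Lemma adj_inj : injective adj.
Proof.
move=> i j eq_ij; apply: val_inj => /=; have := val_adj j (lo i).
by rewrite -eq_ij val_adj /= eqxx; do !case: ifP => ?; lia.
Qed.

(** The two exchanged values are consecutive, so no third value lies between them and only their own
    pair changes order. *)
Lemma adj_mono i a b : (a < b)%N -> (a, b) != (lo i, hi i) ->
  (adj i a < adj i b)%N.
Proof.
rewrite xpair_eqE -(inj_eq val_inj a) -(inj_eq val_inj b) /= val_hi.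
by rewrite !val_adj; do !case: ifP => ?; lia.
Qed.

Definition inversions w := [set p : I * I | (p.1 < p.2)%N && (w p.2 < w p.1)%N]%SET.
Definition ninv w := #|inversions w|.

Lemma perm_ltn_asym w a b : a != b -> (w a < w b)%N = ~~ (w b < w a)%N.
Proof.
rewrite -(inj_eq (@perm_inj _ w)) -val_eqE /=; by case: ltngtP.
Qed.

(** Products apply the left factor first, so left multiplication by [adj i] permutes positions. It
    transports the inversions of [w] bijectively, and the pair [(lo i, hi i)] is the one new
    inversion. *)
Lemma inv_adj_ascent i w : (w (lo i) < w (hi i))%N ->
  ninv (adj i * w) = (ninv w).+1.
Proof.
move=> asc; pose s (p : I * I) := (adj i p.1, adj i p.2).
have sK : involutive s.
  by case=> a b; rewrite /s /= -!permM adjK !perm1.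
have adjE a : adj i (adj i a) = a by rewrite -permM adjK perm1.
have InvS p : (p \in s @: inversions w) = (s p \in inversions w).
  by rewrite -{1}[p]sK mem_imset //; exact: inv_inj.
rewrite /ninv; suff -> : inversions (adj i * w) = ((lo i, hi i) |: s @: inversions w)%SET.
  rewrite cardsU1 card_imset; last exact: inv_inj sK.
  by rewrite InvS inE /= /adj tpermL tpermR [(hi i < _)%N]ltnNge ltnW ?lo_lt_hi.
apply/setP=> -[a b]; rewrite in_setU1 InvS !inE /= !permM.
have [[-> ->]|ne] /= := eqVneq (a, b) (lo i, hi i).
  by rewrite lo_lt_hi /adj tpermL tpermR.
have [lt_ab|le_ba] := ltnP a b; first by rewrite adj_mono.
have [lt_ab|//] := ltnP (adj i a) (adj i b).
(* For [b <= a], the images under [adj i] can be increasing only if [a = hi i] and [b = lo i]; the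
   ascent of [w] then excludes an inversion. *)
have [e|ne'] := eqVneq (adj i a, adj i b) (lo i, hi i).
  have [<- <-] : (hi i, lo i) = (a, b).
    by case: e => /(congr1 (adj i)) + /(congr1 (adj i));
      rewrite !adjE /adj tpermL tpermR => -> ->.
  by rewrite /adj tpermL tpermR ltnNge ltnW.
by have := adj_mono lt_ab ne'; rewrite !adjE ltnNge le_ba.
Qed.

Lemma inv_adj_descent i w : (w (hi i) < w (lo i))%N ->
  ninv w = (ninv (adj i * w)).+1.
Proof.
move=> desc; rewrite -(@inv_adj_ascent i) ?adjKl //.
by rewrite !permM /adj tpermL tpermR.
Qed.

Lemma hi_lo_cases w i : (w (lo i) < w (hi i))%N \/ (w (hi i) < w (lo i))%N.
Proof.
have := lo_neq_hi i; rewrite -(inj_eq (@perm_inj _ w)) -val_eqE /=.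
by case: ltngtP => //; [left|right].
Qed.

Lemma inv_adj_le i w : (ninv (adj i * w) <= (ninv w).+1)%N.
Proof.
have [asc|desc] := hi_lo_cases w i; first by rewrite inv_adj_ascent.
by rewrite (inv_adj_descent desc) -addn2 leq_addr.
Qed.

Lemma inv1 : ninv 1 = 0%N.
Proof.
by apply: eq_card0 => -[a b]; rewrite !inE !perm1 /=; case: ltngtP.
Qed.

(** A strictly increasing map of a finite chain to itself satisfies [a <= w a] by induction from the
    bottom and [w a <= a] by induction from the top. *)
Lemma perm_ascents w : (forall i, w (lo i) < w (hi i))%N -> w = 1.
Proof.
move=> asc.
have step a b : b = a.+1 :> nat -> (w a < w b)%N.
  move=> ba; have am : (a < m)%N by rewrite -ltnS -ba ltn_ord.
  have -> : a = lo (Ordinal am) by apply: val_inj.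
  have -> : b = hi (Ordinal am) by apply: val_inj; rewrite /= val_hi.
  exact: asc.
have ge_id k : forall a, val a = k -> (a <= w a)%N.
  elim: k => [|k IH] a ak; first by rewrite ak.
  have km : (k < m.+1)%N by rewrite ltnW // -ak ltn_ord.
  by rewrite ak; apply: leq_ltn_trans (IH (Ordinal km) erefl) (step _ _ _).
have le_id k : forall a, (m - a)%N = k -> (w a <= a)%N.
  elim: k => [|k IH] a ak; first by have := ltn_ord (w a); lia.
  have km : (a.+1 < m.+1)%N by lia.
  have := step a (Ordinal km) erefl; have := IH (Ordinal km); rewrite /=; lia.
apply/permP=> a; rewrite perm1; apply: val_inj => /=; apply/eqP.
by rewrite eqn_leq (ge_id a) ?(le_id (m - a)%N).
Qed.

(** Induction on the number of inversions: a permutation other than 1 has a descent, and multiplying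
    by that transposition removes one inversion. *)
Lemma perm_ind_inv (P : W -> Prop) : P 1 ->
  (forall i w, (w (lo i) < w (hi i))%N -> P w -> P (adj i * w)) ->
  forall w, P w.
Proof.
move=> P1 PS w; have [k] := ubnP (ninv w); elim: k w => // k IH w wk.
have [/forallP asc|/forallPn [i]] := boolP [forall i, w (lo i) < w (hi i)]%N.
  by rewrite (perm_ascents asc).
have [->//|desc _] := hi_lo_cases w i.
rewrite -[w](adjKl i); apply: PS.
  by rewrite !permM /adj tpermL tpermR.
by apply: IH; move: wk; rewrite (inv_adj_descent desc).
Qed.

Definition wprod (ws : seq 'I_m) : W := \prod_(i <- ws) adj i.

Lemma inv_wprod ws : (ninv (wprod ws) <= size ws)%N.
Proof.
elim: ws => [|i ws IH]; rewrite /wprod ?big_nil ?inv1 // big_cons.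
exact: leq_trans (inv_adj_le _ _) _.
Qed.

Lemma reduced_word w : exists2 ws, wprod ws = w & size ws = ninv w.
Proof.
elim/perm_ind_inv: w => [|i w asc [ws ew sz]].
  by exists [::]; rewrite ?inv1 // /wprod big_nil.
exists (i :: ws); first by rewrite /wprod big_cons -/(wprod ws) ew.
by rewrite inv_adj_ascent //= sz.
Qed.

(** * Reduced words and the universal property (Matsumoto's theorem in type A) *)

Section Universal.
Variables (H : groupType) (F : 'I_m -> H).
Hypothesis FK : forall i, F i * F i = 1.
Hypothesis Fcomm : forall i j, (i.+1 < j)%N -> F i * F j = F j * F i.
Hypothesis Fbraid : forall i j, j = i.+1 :> nat ->
  F i * F j * F i = F j * F i * F j.

Definition hprod (ws : seq 'I_m) : H := \prod_(i <- ws) F i.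

Definition reduced ws := size ws = ninv (wprod ws).

Lemma wprod_cons i ws : wprod (i :: ws) = adj i * wprod ws.
Proof. by rewrite /wprod big_cons. Qed.

Lemma hprod_cons i ws : hprod (i :: ws) = F i * hprod ws.
Proof. by rewrite /hprod big_cons. Qed.

(** Each letter changes the number of inversions by exactly one, so a word is reduced precisely when
    every letter, read from the right, meets an ascent. *)
Lemma reduced_cons i ws : reduced (i :: ws) <->
  reduced ws /\ (wprod ws (lo i) < wprod ws (hi i))%N.
Proof.
rewrite /reduced wprod_cons /=.
have [asc|desc] := hi_lo_cases (wprod ws) i.
  by rewrite inv_adj_ascent //; split=> [[]|[->]].
have := inv_wprod ws; have := inv_adj_descent desc.
by move=> e1 e2; split=> [|[]]; lia.
Qed.

Lemma adj_comm i j : (i.+1 < j)%N -> adj i * adj j = adj j * adj i.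
Proof.
move=> ij; apply/permP=> a; apply: val_inj; rewrite !permM /= !val_adj.
by do !case: ifP; lia.
Qed.

Lemma adj_braid i j : j = i.+1 :> nat ->
  adj i * adj j * adj i = adj j * adj i * adj j.
Proof.
move=> ij; apply/permP=> a; apply: val_inj; rewrite !permM /= !val_adj.
by do !case: ifP; lia.
Qed.

Lemma adj_neq i a : a != i :> nat -> a != i.+1 :> nat -> adj i a = a.
Proof.
by move=> /negPf ai /negPf ai1; apply: val_inj; rewrite /= val_adj ai ai1.
Qed.

Lemma reduced_descent i ws : reduced (i :: ws) ->
  (wprod (i :: ws) (hi i) < wprod (i :: ws) (lo i))%N.
Proof.
move=> /reduced_cons [_ asc].
by rewrite wprod_cons !permM /adj tpermL tpermR.
Qed.

(* Both words are compared with a third one, obtained by extracting from the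
   common value the longest element of the parabolic subgroup generated by the
   two initial letters. *)
Lemma reduced_hprod us vs : reduced us -> reduced vs ->
  wprod us = wprod vs -> hprod us = hprod vs.
Proof.
have [k] := ubnP (size us); elim: k us vs => // k IH us vs uk ru rv e.
have suv : size us = size vs by rewrite ru rv e.
case: us vs => [|i us] [|j vs] // in uk ru rv e suv *.
wlog ij : i j us vs uk ru rv e suv / (i <= j)%N.
  move=> WL; have [|/ltnW ji] := leqP i j; first exact: WL.
  by symmetry; apply: WL => //; rewrite -suv.
case: suv => suv; rewrite /= ltnS in uk.
have [ru' _] := (reduced_cons _ _).1 ru; have [rv' _] := (reduced_cons _ _).1 rv.
have di := reduced_descent ru; have := reduced_descent rv.
rewrite -e => dj; set w := wprod (i :: us) in di dj.
have ei : wprod us = adj i * w by rewrite /w wprod_cons adjKl.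
have ej : wprod vs = adj j * w by rewrite /w e wprod_cons adjKl.
have IHu ts : reduced ts -> wprod ts = wprod us -> hprod us = hprod ts.
  by move=> rt et; apply: IH.
have IHv ts : reduced ts -> wprod ts = wprod vs -> hprod vs = hprod ts.
  by move=> rt et; apply: IH => //; rewrite -suv.
rewrite !hprod_cons.
(* Equal initial letters cancel; neighbouring ones are handled by the braid relation, distant ones
   by commutation. *)
move: ij; rewrite leq_eqVlt => /orP [/eqP/val_inj eij|].
  by subst j; congr (_ * _); apply: IHu => //; rewrite ei ej.
rewrite leq_eqVlt => /orP [/eqP ij|ij].
  have [ts et rt] := reduced_word (adj i * (adj j * (adj i * w))).
  rewrite -et in rt.
  have lj : lo j = hi i by apply: val_inj; rewrite /= val_hi.
  rewrite lj in dj.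
  have jp : adj j (lo i) = lo i by apply: adj_neq; rewrite /= -ij; lia.
  have ir : adj i (hi j) = hi j by apply: adj_neq; rewrite val_hi /= -ij; lia.
  have ip : adj i (lo i) = hi i by rewrite /adj tpermL.
  have iq : adj i (hi i) = lo i by rewrite /adj tpermR.
  have jq : adj j (hi i) = hi j by rewrite /adj lj tpermL.
  have jr : adj j (hi j) = hi i by rewrite /adj lj tpermR.
  have tp : wprod ts (lo i) = w (hi j) by rewrite et !permM ip jq ir.
  have tq : wprod ts (hi i) = w (hi i) by rewrite et !permM iq jp ip.
  have tr : wprod ts (hi j) = w (lo i) by rewrite et !permM ir jr iq.
  (* Descents at both [i] and [j] make [w] decreasing on three consecutive points, so every letter
     of [i j i] and of [j i j] can be split off with a drop in length. *)
  have pr := ltn_trans dj di.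
  have br := adj_braid (esym ij).
  rewrite (IHu [:: j, i & ts]); first 1 last.
  - by apply/reduced_cons; split; first (apply/reduced_cons; split=> //);
      rewrite ?wprod_cons ?permM ?lj ?iq ?ir ?tp ?tq ?tr.
  - by rewrite !wprod_cons ei et !adjKl.
  rewrite (IHv [:: i, j & ts]); first 1 last.
  - by apply/reduced_cons; split; first (apply/reduced_cons; split=> //);
      rewrite ?wprod_cons ?permM ?lj ?jp ?jq ?tp ?tq ?tr.
  - by rewrite !wprod_cons ej et !mulgA br -!mulgA !adjKl.
  by rewrite !hprod_cons !mulgA (Fbraid (esym ij)).
have [ts et rt] := reduced_word (adj j * (adj i * w)).
rewrite -et in rt.
have jp : adj j (lo i) = lo i by apply: adj_neq; rewrite /=; lia.
have jq : adj j (hi i) = hi i by apply: adj_neq; rewrite val_hi; lia.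
have ip : adj i (lo j) = lo j by apply: adj_neq; rewrite /=; lia.
have iq : adj i (hi j) = hi j by apply: adj_neq; rewrite val_hi; lia.
rewrite (IHu (j :: ts)); first 1 last.
- by apply/reduced_cons; rewrite et !permM {2 4}/adj tpermL tpermR ip iq.
- by rewrite wprod_cons et adjKl ei.
rewrite (IHv (i :: ts)); first 1 last.
- by apply/reduced_cons; rewrite et !permM jp jq /adj tpermL tpermR.
- by rewrite wprod_cons et ej (mulgA (adj j)) -(adj_comm ij) -!mulgA adjKl.
by rewrite !hprod_cons !mulgA (Fcomm ij).
Qed.

(** The image of [w] is the product along a chosen reduced word. Independence of the choice gives
    compatibility with left multiplication by a letter, whence multiplicativity by induction. *)
Lemma universal_hom :
  exists phi : {multiplicative W -> H}, forall i, phi (adj i) = F i.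
Proof.
have /choice [word wordP] w : exists ws, wprod ws = w /\ reduced ws.
  by have [ws e sz] := reduced_word w; exists ws; rewrite /reduced e.
pose phi w := hprod (word w).
have phiE ws : reduced ws -> phi (wprod ws) = hprod ws.
  by move=> rws; have [e rd] := wordP (wprod ws); apply: reduced_hprod.
have phi_asc i w : (w (lo i) < w (hi i))%N -> phi (adj i * w) = F i * phi w.
  move=> asc; have [e rd] := wordP w; rewrite -{1}e -wprod_cons phiE ?hprod_cons //.
  by apply/reduced_cons; rewrite e.
have phi_adj i w : phi (adj i * w) = F i * phi w.
  have [/phi_asc //|desc] := hi_lo_cases w i.
  (* At a descent the ascent rule applies to [adj i * w], and [FK] cancels the two letters. *)
  rewrite -{2}[w](adjKl i) (phi_asc i (adj i * w)) ?mulgA ?FK ?mul1g //.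
  by rewrite !permM /adj tpermL tpermR.
have phi1 : phi 1 = 1.
  have -> : 1 = wprod [::] by rewrite /wprod big_nil.
  by rewrite phiE /hprod ?big_nil // /reduced /wprod big_nil inv1.
have phiM : {morph phi : v w / v * w}.
  move=> v w; elim/perm_ind_inv: v => [|i v _ IH]; first by rewrite phi1 !mul1g.
  by rewrite -mulgA !phi_adj IH mulgA.
exists (HB.pack_for {multiplicative W -> H} phi
  (isMultiplicative.Build W H phi phiM)).
by move=> i; rewrite /= -[adj i]mulg1 phi_adj phi1 mulg1.
Qed.

End Universal.

(** * Orders of products of adjacent transpositions and the Coxeter axiom *)

Lemma adj_order i : has_order (adj i * adj i) 1.
Proof. by split=> [//||[]//]; rewrite ?adjK ?expg1. Qed.

Lemma adj_order_comm i j : (i.+1 < j)%N -> has_order (adj i * adj j) 2.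
Proof.
move=> ij; split=> // [|[|[|//]]//].
  by rewrite expgS expg1 {1}(adj_comm ij) -!mulgA !adjKl adjK.
move=> _ _; rewrite expg1 => /(congr1 (fun w => w * adj j)).
rewrite -mulgA adjK mulg1 mul1g => /adj_inj e.
by rewrite e ltnNge leqnSn in ij.
Qed.

Lemma adj_order_braid i j : j = i.+1 :> nat -> has_order (adj i * adj j) 3.
Proof.
move=> ij; have br := adj_braid ij.
have e3 : (adj i * adj j) ^+ 3 = 1.
  by rewrite !expgS expg0 mulg1 !mulgA br -!mulgA !adjKl adjK.
have ne1 : (adj i * adj j) <> 1.
  move=> /(congr1 (fun w => w * adj j)).
  by rewrite -mulgA adjK mulg1 mul1g => /adj_inj e; rewrite e in ij; lia.
split=> // -[//|[|[|//]]] _ _; first by rewrite expg1.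
by move=> e2; apply: ne1; rewrite -e3 expgSr e2 mul1g.
Qed.

Definition adjs : set W := [set adj i | i in setT].

(** Equal, distant and neighbouring letters have products of order 1, 2 and 3. Since the images are
    involutions, these power relations become the involution, commutation and braid relations
    required by [universal_hom]. *)
Lemma symmetric_coxeter : is_coxeter adjs.
Proof.
split.
- apply/seteqP; split=> // w _; elim/perm_ind_inv: w => [|i w _ IH].
    by have [] := gen_subgroupP adjs.
  have [_ HM _] := gen_subgroupP adjs.
  by apply: HM => //; apply: sub_gen_subgroup; exists i.
- move=> _ [i _ <-]; split=> [//||[|[|//]]//].
    by rewrite expgS expg1 adjK.
  move=> _ _; rewrite expg1 => /permP/(_ (lo i)) /eqP.
  by rewrite perm1 /adj tpermL eq_sym (negPf (lo_neq_hi i)).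
move=> H f fP; pose F i := f (adj i).
have FP i j k : has_order (adj i * adj j) k -> (F i * F j) ^+ k = 1.
  by apply: fP; [exists i|exists j].
have FK i : F i * F i = 1 by rewrite -(FP i i 1%N) ?expg1 //; exact: adj_order.
have FKl i x : F i * (F i * x) = x by rewrite mulgA FK mul1g.
have [||phi phiE] := @universal_hom H F FK.
- move=> i j /adj_order_comm/FP; rewrite expgS expg1 => e.
  by rewrite -[RHS]mulg1 -e -!mulgA !FKl.
- move=> i j /adj_order_braid/FP; rewrite !expgS expg0 mulg1 !mulgA => e.
  by rewrite -[RHS]mul1g -e -!mulgA !FKl FK mulg1.
by exists phi => _ [i _ <-].
Qed.

End Symmetric.
Definition symmetric_system m := CoxeterSystem (symmetric_coxeter m).

(** * Length function and roots in type A *)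

Section SymmetricRoots.
Variable m : nat.
Local Notation I := 'I_m.+1.
Local Notation W := {perm I}.
Local Notation C := (symmetric_system m).
Implicit Types (w v : W) (a b c d : I) (i : 'I_m).

(** A reduced word attains the inversion number, and no word is shorter because each letter adds at
    most one inversion. *)
Lemma cox_lengthE (w : cox_group C) : cox_length w = ninv (w : W).
Proof.
apply: infimum_eq; first have [ws e sz] := reduced_word w.
  exists [seq adj i | i <- ws]; last by rewrite size_map sz.
  split; last by rewrite big_map; exact: e.
  by move=> _ /mapP [i _ ->]; exists i.
move=> _ [ws [wsS <-] <-].
have [us ->] : exists us : seq 'I_m, ws = [seq adj i | i <- us].
  elim: ws wsS => [|v ws IH] wsS; first by exists [::].
  have [|us ->] := IH; first by move=> x xws; apply: wsS; rewrite /= in_cons xws orbT.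
  have [i _ <-] : adjs (v : W) by apply: wsS; rewrite /= in_cons eqxx.
  by exists (i :: us).
by rewrite size_map big_map; apply: inv_wprod.
Qed.

Definition perm_root a b : set W := [set w : W | (w a < w b)%N].

Lemma simple_rootE i : @simple_root C (adj i) = perm_root (lo i) (hi i).
Proof.
apply/seteqP; split=> w; rewrite /perm_root /simple_root /= !cox_lengthE.
  have [//|/inv_adj_descent ->] := hi_lo_cases w i.
  by rewrite ltnNge leqnSn.
by move/inv_adj_ascent ->.
Qed.

Lemma ltrans_root v a b : @ltrans C v (perm_root a b) = perm_root (v^-1 a) (v^-1 b).
Proof.
apply/seteqP; split=> [_ [w /= wab <-]|w wab].
  by rewrite /perm_root /= !permM !permKV.
by exists (v^-1 * w); [rewrite /perm_root /= !permM | rewrite mulKVg].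
Qed.

Lemma setC_root a b : a != b -> ~` perm_root a b = perm_root b a.
Proof.
move=> ab; apply/seteqP; split=> w; rewrite /perm_root /=.
  by rewrite (perm_ltn_asym w ab) => /negP; rewrite negbK.
by move=> ba /(ltn_trans ba); rewrite ltnn.
Qed.

(** If [a] and [b] have images in the wrong order, exchange them first; this leaves the image of [c]
    unchanged. *)
Lemma root_prescribed a b c d : a != b -> c != a -> c != b ->
  exists2 w, perm_root a b w & w c = d.
Proof.
move=> ab ca cb; have [w wc] : exists w, w c = d by exists (tperm c d); rewrite tpermL.
have [wab|wba] := boolP (w a < w b)%N; first by exists w.
exists (tperm a b * w); last by rewrite permM tpermD // 1?eq_sym.
by rewrite /perm_root /= !permM tpermL tpermR perm_ltn_asym // eq_sym.
Qed.

(** Since [perm_root d c] is the complement of [perm_root c d], this separates distinct roots. The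
    witness gives [d] the least value or, when [d = b], gives [c] the greatest one. *)
Lemma root_separation a b c d : a != b -> c != d -> (c, d) != (a, b) ->
  exists2 w, perm_root a b w & perm_root d c w.
Proof.
move=> ab cd; rewrite xpair_eqE => ne.
have below w x y : x != y -> w x = ord0 -> perm_root x y w.
  move=> xy wx; rewrite /perm_root /= wx /= lt0n.
  by rewrite -(inj_eq (@perm_inj _ w)) wx eq_sym -val_eqE in xy.
have above w x y : x != y -> w y = ord_max -> perm_root x y w.
  move=> xy wy; rewrite /perm_root /= wy /= ltn_neqAle -ltnS ltn_ord andbT.
  by rewrite -(inj_eq (@perm_inj _ w)) wy -val_eqE in xy.
have [da|da] := eqVneq d a.
  exists (tperm a ord0); first by apply: below; rewrite ?tpermL.
  by rewrite da; apply: below; rewrite ?tpermL // -da eq_sym.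
have [db|db] := eqVneq d b.
  rewrite db eqxx andbT in ne; rewrite db in cd.
  have [w wab wc] := root_prescribed ord_max ab ne cd.
  by exists w => //; apply: above; rewrite // db eq_sym.
have [w wab wd] := root_prescribed ord0 ab da db.
by exists w => //; apply: below; rewrite // eq_sym.
Qed.

Lemma root_inj a b c d : a != b -> c != d -> perm_root a b = perm_root c d ->
  a = c /\ b = d.
Proof.
move=> ab cd e; have [[-> ->]//|ne] := eqVneq (c, d) (a, b).
have [w] := root_separation ab cd ne; rewrite e /perm_root /= => lt_cd.
by rewrite ltnNge ltnW.
Qed.

Lemma cox_rootsE : @cox_roots C = [set alpha | exists a b, a != b /\ alpha = perm_root a b].
Proof.
apply/seteqP; split=> [_ [v _ [_ [i _ <-] <-]]|_ [a [b [ab ->]]]].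
  rewrite simple_rootE ltrans_root; do 2!eexists; split; last by [].
  by rewrite (inj_eq perm_inj) lo_neq_hi.
(* Distinct indices force [0 < m], so a simple root exists. The permutation [w] sends [a], [b] to
   [lo i], [hi i]: the first transposition places [a], the second places [b] and fixes [lo i]. *)
have m0 : (0 < m)%N.
  by case: m a b ab => // a b; rewrite (ord1 a) (ord1 b) eqxx.
pose i := Ordinal m0; pose v := tperm a (lo i).
have va : v a = lo i by rewrite /v tpermL.
have vb : v b != lo i by rewrite -va (inj_eq perm_inj) eq_sym.
pose w := v * tperm (v b) (hi i).
have wa : w a = lo i by rewrite permM va tpermD // eq_sym lo_neq_hi.
have wb : w b = hi i by rewrite permM tpermL.
exists w => //; exists (adj i); first by exists i.
by rewrite simple_rootE ltrans_root -wa -wb !permK.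
Qed.

Lemma mem_cox_roots a b : a != b -> @cox_roots C (perm_root a b).
Proof. by rewrite cox_rootsE => ab; exists a, b. Qed.

Lemma pos_rootP alpha : @pos_roots C alpha ->
  exists a b, (a < b)%N /\ alpha = perm_root a b.
Proof.
rewrite /pos_roots /= cox_rootsE => -[[a [b [ab ->]]]].
by rewrite /perm_root /= !perm1; exists a, b.
Qed.

Lemma pos_roots_root a b : (a < b)%N -> @pos_roots C (perm_root a b).
Proof.
move=> ab; split; first by apply: mem_cox_roots; rewrite neq_ltn ab.
by rewrite /perm_root /= !perm1.
Qed.

Lemma not_prenilpotent_opp a b : ~ @prenilpotent C (perm_root a b) (perm_root b a).
Proof. by move=> [[w [/= /ltnW]]]; rewrite leqNgt => /negP. Qed.

(** This root will carry the commutator of the two root groups; it lies in the interval by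
    transitivity of the order and of its reverse. *)
Lemma open_interval_root a b c : a != b -> b != c -> a != c ->
  @open_root_interval C (perm_root a b) (perm_root b c) (perm_root a c).
Proof.
move=> ab bc ac; split; last first.
  by case=> /root_inj [] // e1 e2; [move: bc|move: ab]; rewrite ?e1 ?e2 eqxx.
split; first exact: mem_cox_roots.
  by move=> w [/= wab wbc]; apply: ltn_trans wbc.
rewrite !setC_root // => w [/= wba wcb]; exact: ltn_trans wba.
Qed.

Lemma open_root_intervalC (alpha beta : set W) :
  @open_root_interval C alpha beta = @open_root_interval C beta alpha.
Proof.
by rewrite /open_root_interval /root_interval setIC setUC [~` _ `&` _]setIC.
Qed.

End SymmetricRoots.

(** * Commutator subgroups and nilpotency class *)

Section Commutators.
Variable G : groupType.
Implicit Types (A B H : set G) (x y z : G).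

Lemma commg_eq x y z : x * y = y * x * z -> [~ x, y] = z.
Proof. by move=> e; apply: (mulgI (y * x)); rewrite -commgC. Qed.

Lemma comm_subgroup_min A B H : is_subgroup H ->
  (forall x y, A x -> B y -> H [~ x, y]) -> comm_subgroup A B `<=` H.
Proof.
by move=> HH AB; apply: gen_subgroup_min => // _ [x Ax [y By <-]]; apply: AB.
Qed.

Lemma mem_comm_subgroup A B x y : A x -> B y -> comm_subgroup A B [~ x, y].
Proof. by move=> Ax By; apply: sub_gen_subgroup; exists x => //; exists y. Qed.

Lemma lower_central_subgroup H c : is_subgroup H ->
  is_subgroup (lower_central H c).
Proof. by case: c => // c _; apply: gen_subgroupP. Qed.

End Commutators.

Section NilpotencyClass.
Variable G : groupType.
Implicit Type H : set G.

Lemma nilpotency_class_eq H c : lower_central H c = [set 1] ->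
  (forall k, (k < c)%N -> lower_central H k <> [set 1]) ->
  nilpotency_class H = (c%:Z%:E)%E.
Proof.
move=> Hc lt_c; apply: infimum_eq; first by exists c.
by move=> _ [k Hk <-]; rewrite lee_fin lez_nat leqNgt; apply/negP => /lt_c.
Qed.

Lemma nilpotency_class_le H c : lower_central H c = [set 1] ->
  (nilpotency_class H <= c%:Z%:E)%E.
Proof.
move=> Hc; have exH : exists k, `[< lower_central H k = [set 1] >].
  by exists c; apply/asboolP.
case: (ex_minnP exH) => k /asboolP Hk min_k.
rewrite (nilpotency_class_eq Hk) ?lee_fin ?lez_nat; first by apply/min_k/asboolP.
by move=> l lk /asboolP /min_k; rewrite leqNgt lk.
Qed.

End NilpotencyClass.

(** * The group generated by elementary matrices over F_2 *)

Section Elementary.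
Variable m : nat.
Local Notation I := 'I_m.+1.
Local Notation M := 'M['F_2]_m.+1.
Implicit Types (a b c d : I) (i : 'I_m).

Lemma F2_addxx (V : lmodType 'F_2) (x : V) : (x + x = 0)%R.
Proof.
by rewrite -mulr2n -scaler_nat (_ : 2%:R = 0 :> 'F_2)%R ?scale0r //; apply: val_inj.
Qed.

Lemma mul_delta a b c d : (delta_mx a b * delta_mx c d =
  if b == c then delta_mx a d else 0 :> M)%R.
Proof.
rewrite -mulmxE; case: eqVneq => [->|bc]; first by rewrite mul_delta_mx.
by rewrite mul_delta_mx_0.
Qed.

Lemma transvection_sqr a b : a != b ->
  ((1 + delta_mx a b) * (1 + delta_mx a b) = 1 :> M)%R.
Proof.
move=> ab; rewrite mulrDl mul1r mulrDr mulr1 mul_delta eq_sym (negPf ab).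
by rewrite addr0 -addrA F2_addxx addr0.
Qed.

(** Presents the group through an injective multiplicative map [mx], so that identities between its
    elements can be checked in the matrix ring. *)
Lemma elementary_group : exists (G : groupType) (X : I -> I -> G) (mx : G -> M),
  [/\ mx 1 = 1%R, {morph mx : g h / g * h >-> (g * h)%R}, injective mx,
      forall a b, a != b -> mx (X a b) = (1 + delta_mx a b)%R
    & gen_subgroup [set g | exists a b, a != b /\ g = X a b] = setT].
Proof.
(* For distinct indices the default 1 of [insubd] is never taken: transvections are involutions,
   hence units. *)
pose t (p : I * I) : {unit M} := insubd (1 : {unit M}) (1 + delta_mx p.1 p.2 : M)%R.
pose T := (t @: [set p : I * I | p.1 != p.2])%SET.
have Tt a b : a != b -> t (a, b) \in T.
  by move=> ab; apply/imsetP; exists (a, b); rewrite ?inE.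
exists (subg_of <<T>>), (fun a b => subg <<T>> (t (a, b))), 
  (fun g => FinRing.uval (sgval g)).
split=> //.
- by move=> g h /val_inj /val_inj.
- move=> a b ab; rewrite subgK; last by apply/mem_gen/Tt.
  rewrite val_insubd ifT //; apply/unitrP.
  by exists (1 + delta_mx a b)%R; rewrite transvection_sqr.
(* In a finite group every element of the generated subgroup is a product of generators, without
   inverses. *)
apply/seteqP; split=> // g _; have /gen_prodgP [k [c cT e]] := valP g.
have -> : g = \prod_(i < k) subg <<T>> (c i).
  apply: val_inj; rewrite e; elim/big_rec2: _ => //= i y x _ ->.
  by rewrite subgK //; apply/mem_gen.
have [S1 SM _] := gen_subgroupP [set g | exists a b, a != b /\ g = subg <<T>> (t (a, b))].
elim/big_ind: _ => // i _; apply: sub_gen_subgroup.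
have /imsetP [[a b]] := cT i; rewrite inE => ab ->.
by exists a, b.
Qed.

End Elementary.

(** * Relations between transvections, and the root groups *)

Section Transvections.
Variable m : nat.
Local Notation I := 'I_m.+1.
Local Notation M := 'M['F_2]_m.+1.
Variables (G : groupType) (X : I -> I -> G) (mx : G -> M).
Hypothesis mx1 : mx 1 = 1%R.
Hypothesis mxM : {morph mx : g h / g * h >-> (g * h)%R}.
Hypothesis mx_inj : injective mx.
Hypothesis mxX : forall a b, a != b -> mx (X a b) = (1 + delta_mx a b)%R.
Implicit Types (a b c d : I) (i : 'I_m) (g h : G).

Lemma XX a b : a != b -> X a b * X a b = 1.
Proof. by move=> ab; apply: mx_inj; rewrite mxM mxX // transvection_sqr ?mx1. Qed.

Lemma XV a b : a != b -> (X a b)^-1 = X a b.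
Proof. by move=> /XX e; apply: (mulgI (X a b)); rewrite mulgV e. Qed.

Lemma X_neq1 a b : a != b -> X a b <> 1.
Proof.
move=> ab /(congr1 mx); rewrite mxX // mx1 => /matrixP /(_ a b).
by rewrite !mxE !eqxx (negPf ab).
Qed.

Lemma X_commute a b c d : a != b -> c != d -> b != c -> a != d ->
  X a b * X c d = X c d * X a b.
Proof.
move=> ab cd bc ad; apply: mx_inj; rewrite !mxM !mxX //.
rewrite !(mulrDl, mulrDr, mul1r, mulr1) !mul_delta (negPf bc).
by rewrite eq_sym (negPf ad) !addr0 addrAC.
Qed.

(** Steinberg's commutator relation: among the products of E_ab, E_bc and E_ac only E_ab E_bc = E_ac
    is nonzero. *)
Lemma commgX a b c : a != b -> b != c -> a != c -> [~ X a b, X b c] = X a c.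
Proof.
move=> ab bc ac; apply: commg_eq; apply: mx_inj; rewrite !mxM !mxX //.
rewrite !(mulrDl, mulrDr, mul1r, mulr1) !mul_delta eqxx.
rewrite ![c == a]eq_sym ![b == a]eq_sym (negPf ab) (negPf ac).
rewrite !(addr0, add0r, mul0r).
by rewrite !addrA; congr (_ + _)%R; rewrite addrAC.
Qed.

(** The usual representative of a reflection, a monomial matrix with entries 1 and -1; in
    characteristic 2 it is a permutation matrix. *)
Lemma XXX_tperm a b : a != b -> mx (X b a * X a b * X b a) = tperm_mx a b.
Proof.
move=> ab; have ba : b != a by rewrite eq_sym.
rewrite !mxM !mxX // !(mulrDl, mulrDr, mul1r, mulr1) !mul_delta !eqxx (negPf ab).
rewrite !mul_delta !eqxx !add0r.
apply/matrixP=> i j; rewrite !mxE.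
have eqS x : (x == j) = (j == x) by rewrite eq_sym.
case: tpermP => [->|->|/eqP/negPf -> /eqP/negPf ->];
  rewrite ?eqS ?eqxx ?(negPf ab) ?(negPf ba) /=; last by rewrite !addr0.
all: have [->|ja] := eqVneq j a; first by rewrite (negPf ab); apply: val_inj.
all: by case: eqP => _; apply: val_inj.
Qed.

(** The indices are quantified because a root is given only as a set; [root_inj] recovers them. On
    sets that are not roots the value is trivial. *)
Definition root_group (alpha : set {perm I}) : set G :=
  [set g | g = 1 \/ exists a b, [/\ a != b, alpha = perm_root a b & g = X a b]].

Lemma root_groupE a b : a != b -> root_group (perm_root a b) = [set 1; X a b].
Proof.
move=> ab; apply/seteqP; split=> g /= [->|]; [by left| |by left|].
  by move=> [c [d [cd /root_inj [] // -> -> ->]]]; right.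
by move=> ->; right; exists a, b.
Qed.

Lemma X_root_group a b : a != b -> root_group (perm_root a b) (X a b).
Proof. by move=> ab; rewrite root_groupE //; right. Qed.

Lemma root_group_subgroup a b : a != b -> is_subgroup (root_group (perm_root a b)).
Proof.
move=> ab; rewrite root_groupE //; split=> [|x y|x] /=; first by left.
  by move=> [->|->] [->|->]; rewrite ?mulg1 ?mul1g ?XX //; [left|right|right|left].
by move=> [->|->]; rewrite ?invg1 ?XV //; [left|right].
Qed.

Lemma comm_root_group H a b c d : a != b -> c != d -> is_subgroup H ->
  H [~ X a b, X c d] ->
  comm_subgroup (root_group (perm_root a b)) (root_group (perm_root c d)) `<=` H.
Proof.
move=> ab cd HH Hc; apply: comm_subgroup_min => // x y.
rewrite !root_groupE //; have [H1 _ _] := HH.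
by move=> [->|->] [->|->] //; rewrite ?comm1g ?commg1.
Qed.

(** If the index pairs chain in one order or the other, the commutator is a transvection in the open
    interval; chaining both ways would make the roots opposite, against prenilpotence. Otherwise the
    transvections commute. *)
Lemma rgd1_root_group (C := symmetric_system m) (alpha beta : set (cox_group C)) :
  cox_roots alpha -> cox_roots beta -> prenilpotent alpha beta -> alpha <> beta ->
  comm_subgroup (root_group alpha) (root_group beta) `<=`
    gen_subgroup (\bigcup_(gamma in open_root_interval alpha beta) root_group gamma).
Proof.
rewrite !cox_rootsE => -[a [b [ab ->]]] [c [d [cd ->]]] pn ne.
set H := gen_subgroup _; have HH : is_subgroup H := gen_subgroupP _.
apply: comm_root_group => //.
have [H1 _ HV] := HH.
have [bc|bc] := eqVneq b c.
  subst c; have ad : a != d.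
    by apply/eqP=> e; subst d; apply: not_prenilpotent_opp pn.
  rewrite commgX //; apply: sub_gen_subgroup; exists (perm_root a d).
    exact: open_interval_root.
  exact: X_root_group.
have [ad|ad] := eqVneq a d.
  subst d; rewrite -invg_comm commgX // 1?eq_sym //; apply: HV.
  apply: sub_gen_subgroup; exists (perm_root c b); last by apply: X_root_group; rewrite eq_sym.
  by rewrite open_root_intervalC; apply: open_interval_root; rewrite // eq_sym.
by rewrite (commg_eq (z := 1)) // mulg1 X_commute.
Qed.

(** The conjugating element is the permutation matrix of [adj i], which permutes row and column
    indices. *)
Lemma conj_root_group i a b : a != b ->
  lconj (X (hi i) (lo i) * X (lo i) (hi i) * X (hi i) (lo i))
    (root_group (perm_root a b)) = root_group (perm_root (adj i a) (adj i b)).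
Proof.
move=> ab; set t := (X _ _ * _ * _).
have mxt : mx t = tperm_mx (lo i) (hi i) by apply/XXX_tperm/lo_neq_hi.
have ab' : adj i a != adj i b by rewrite (inj_eq perm_inj).
have tX : t * X a b * t^-1 = X (adj i a) (adj i b).
  apply: (mulIg t); rewrite mulgVK; apply: mx_inj.
  rewrite mxM [RHS]mxM mxt !mxX // mulrDl mulrDr mul1r mulr1; congr (_ + _)%R.
  rewrite -mulmxE /tperm_mx -[tperm _ _]/(adj i) -row_permE.
  rewrite -[adj i in RHS]invgK -col_permE; apply/matrixP=> j k; rewrite !mxE.
  have adjV : (adj i)^-1 = adj i by rewrite tpermV.
  rewrite !adjV (inj_eq perm_inj) -(inj_eq (@perm_inj _ (adj i)) (adj i j)).
  by rewrite -!permM adjK !perm1.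
rewrite !root_groupE //; apply/seteqP; split=> [_ [x /= xU <-]|x /= xU].
  by case: xU => ->; [left; rewrite mulg1 mulgV|right].
by case: xU => ->; [exists 1; [left|rewrite mulg1 mulgV]|exists (X a b); [right|]].
Qed.

(** * The filtration of the unitriangular group by superdiagonals *)

Definition upper k (A : M) := forall a b, (b < a + k)%N -> A a b = 0%R.

(** A matrix in [upper k] is supported on and above the k-th superdiagonal, and these levels add
    under multiplication. *)
Lemma upperM k l A B : upper k A -> upper l B -> upper (k + l) (A * B)%R.
Proof.
move=> uA uB a b lt_b; rewrite !mxE big1 // => c _.
have [lt_c|le_c] := ltnP c (a + k); first by rewrite uA // mul0r.
by rewrite uB ?mulr0 //; lia.
Qed.

Lemma upperD k A B : upper k A -> upper k B -> upper k (A + B)%R.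
Proof. by move=> uA uB a b lt_b; rewrite !mxE uA // uB // addr0. Qed.

Lemma upperN k A : upper k A -> upper k (- A)%R.
Proof. by move=> uA a b lt_b; rewrite !mxE uA // oppr0. Qed.

Lemma upper1 : upper 0 1%R.
Proof. by move=> a b lt_b; rewrite !mxE -val_eqE gtn_eqF // -[val a]addn0. Qed.

Lemma upper_leq k l A : (k <= l)%N -> upper l A -> upper k A.
Proof. by move=> kl uA a b lt_b; apply: uA; lia. Qed.

(** In B = 1 - B A, strict triangularity of A makes each column of B A depend only on earlier
    columns of B; hence induction on the column. *)
Lemma upper_inv A B : (B * (1 + A) = 1)%R -> upper 1 A -> upper 0 B.
Proof.
move=> BA uA.
have eB : B = (1 - B * A)%R by rewrite -BA mulrDr mulr1 addrK.
move=> a b; rewrite addn0; have [k] := ubnP b; elim: k b => // k IH b bk ba.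
rewrite eB !mxE big1 ?subr0 => [|c _]; first by rewrite -val_eqE gtn_eqF.
have [lt_cb|le_bc] := ltnP c b; last by rewrite uA ?mulr0 // addn1 ltnS.
by rewrite IH ?mul0r //; lia.
Qed.

(** The shift matches that of [lower_central]: [unitriangular 0] consists of all unitriangular
    elements. *)
Definition unitriangular k : set G := [set g | upper k.+1 (mx g - 1)%R].

Lemma upper_mx k g : unitriangular k g -> upper 0 (mx g).
Proof.
move=> ug; rewrite -[mx g](subrK 1%R); apply: upperD upper1.
exact: upper_leq ug.
Qed.

Lemma mxV g : (mx g^-1 * mx g = 1)%R.
Proof. by rewrite -mxM mulVg mx1. Qed.

Lemma upper_mxV g k : unitriangular k g -> upper 0 (mx g^-1).
Proof.
move=> ug; apply: (@upper_inv (mx g - 1)%R); first by rewrite addrC subrK mxV.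
exact: upper_leq ug.
Qed.

Lemma unitriangular_subgroup k : is_subgroup (unitriangular k).
Proof.
rewrite /unitriangular; split=> [|g h ug uh|g ug] /=.
- by rewrite mx1 subrr => a b _; rewrite mxE.
- have -> : (mx (g * h)%g - 1 = (mx g - 1) * mx h + (mx h - 1))%R.
    by rewrite mxM mulrBl mul1r addrA subrK.
  apply: upperD => //; rewrite -[k.+1]addn0; apply: upperM => //; exact: upper_mx uh.
- have -> : (mx g^-1 - 1 = - (mx g^-1 * (mx g - 1)))%R.
    by rewrite mulrBr mxV mulr1 opprB.
  by apply: upperN; rewrite -[k.+1]add0n; apply: upperM => //; apply: upper_mxV ug.
Qed.

(** From [g, h] - 1 = (hg)^-1 ((g - 1)(h - 1) - (h - 1)(g - 1)): the levels k + 1 and l + 1 add up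
    to k + l + 2. *)
Lemma commg_unitriangular k l g h : unitriangular k g -> unitriangular l h ->
  unitriangular (k + l).+1 [~ g, h].
Proof.
move=> ug uh; rewrite /unitriangular /=.
have -> : (mx [~ g, h] - 1 =
  mx (h * g)^-1 * ((mx g - 1) * (mx h - 1) - (mx h - 1) * (mx g - 1)))%R.
  apply: (@GRing.mulrI _ (mx (h * g))).
    by apply/unitrP; exists (mx (h * g)^-1); rewrite -!mxM mulVg mulgV mx1.
  rewrite mulrA -(mxM _ (h * g)^-1) mulgV mx1 mul1r mulrBr mulr1 -mxM -commgC !mxM.
  rewrite !(mulrBl, mulrBr) !(mul1r, mulr1).
  by rewrite !opprB addrACA !subrKA.
rewrite -[(k + l).+2]add0n; apply: upperM.
  have [_ HM _] := unitriangular_subgroup 0.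
  by apply: (@upper_mxV _ 0); apply: HM; apply: upper_leq; [|exact: uh| |exact: ug].
have -> : (k + l).+2 = (k.+1 + l.+1)%N by lia.
apply: upperD; first exact: upperM.
by apply: upperN; rewrite addnC; apply: upperM.
Qed.

Lemma X_unitriangular a b k : (a + k < b)%N -> unitriangular k (X a b).
Proof.
move=> ab; rewrite /unitriangular /= mxX; last by rewrite -val_eqE /=; lia.
rewrite addrC addKr => c d cd; rewrite !mxE.
case: andP => // -[/eqP ec /eqP ed]; subst; lia.
Qed.

Lemma unitriangular_max : unitriangular m = [set 1].
Proof.
apply/seteqP; split=> [g ug|_ ->]; last by case: (unitriangular_subgroup m).
apply: mx_inj; rewrite mx1; apply/eqP; rewrite -subr_eq0; apply/eqP/matrixP=> a b.
by rewrite ug ?mxE //; have := ltn_ord b; lia.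
Qed.

(** * The remaining RGD axioms *)

Hypothesis X_gen : gen_subgroup [set g | exists a b, a != b /\ g = X a b] = setT.

Lemma rgd0_root_group (alpha : set (cox_group (symmetric_system m))) :
  cox_roots alpha -> root_group alpha <> [set 1].
Proof.
rewrite cox_rootsE => -[a [b [ab ->]]] e.
by apply: (X_neq1 ab); have := X_root_group ab; rewrite e.
Qed.

Lemma rgd2_root_group (C := symmetric_system m) (s : cox_group C) u :
  cox_gens s -> root_group (simple_root s) u -> u <> 1 ->
  exists u' u'', [/\ root_group (~` simple_root s) u',
    root_group (~` simple_root s) u''
    & forall beta : set (cox_group C), cox_roots beta ->
        lconj (u' * u * u'') (root_group beta) = root_group (ltrans s beta)].
Proof.
move=> [i _ <-]; have lh := lo_neq_hi i; have hl : hi i != lo i by rewrite eq_sym.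
rewrite simple_rootE setC_root // root_groupE // => -[//|-> _].
(* With these factors the triple product is the permutation matrix of the simple reflection. *)
exists (X (hi i) (lo i)), (X (hi i) (lo i)).
split; [exact: X_root_group..|] => beta.
rewrite cox_rootsE => -[a [b [ab ->]]].
by rewrite conj_root_group // ltrans_root tpermV.
Qed.

Lemma pos_root_group (alpha : set (cox_group (symmetric_system m))) :
  pos_roots alpha -> root_group alpha `<=` unitriangular 0.
Proof.
move=> /pos_rootP [a [b [ab ->]]] g; rewrite root_groupE; last first.
  by rewrite neq_ltn ab.
have [U1 _ _] := unitriangular_subgroup 0.
by move=> [->//|->]; apply: X_unitriangular; rewrite addn0.
Qed.

(** Positive root groups generate only unitriangular elements, whereas [X (hi i) (lo i)] has a
    nonzero entry below the diagonal. *)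
Lemma rgd3_root_group (C := symmetric_system m) (s : cox_group C) :
  cox_gens s -> ~ (root_group (~` simple_root s) `<=`
    gen_subgroup (\bigcup_(alpha in @pos_roots C) root_group alpha)).
Proof.
move=> [i _ <-]; have hl : hi i != lo i by rewrite eq_sym lo_neq_hi.
rewrite simple_rootE setC_root ?lo_neq_hi // => sub.
have : unitriangular 0 (X (hi i) (lo i)).
  apply: (gen_subgroup_min (unitriangular_subgroup 0)) (sub _ (X_root_group hl)).
  by move=> g [alpha /pos_root_group]; apply.
move=> /(_ (hi i) (lo i)); rewrite mxX // addrC addKr mxE !eqxx /=.
by rewrite val_hi addn1 ltnS leqW // => /(_ erefl) /eqP; rewrite oner_eq0.
Qed.

Lemma rgd4_root_group (C := symmetric_system m) :
  gen_subgroup ((\bigcup_(alpha in @cox_roots C) root_group alpha) `|`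
    (\bigcap_(alpha in @cox_roots C) normalizer (root_group alpha))) = setT.
Proof.
apply/seteqP; split=> //; rewrite -X_gen.
apply: gen_subgroup_min; first exact: gen_subgroupP.
move=> _ [a [b [ab ->]]]; apply: sub_gen_subgroup; left.
by exists (perm_root a b); [exact: mem_cox_roots|exact: X_root_group].
Qed.

Lemma cox_root_group_subgroup (alpha : set (cox_group (symmetric_system m))) :
  cox_roots alpha -> is_subgroup (root_group alpha).
Proof. by rewrite cox_rootsE => -[a [b [ab ->]]]; apply: root_group_subgroup. Qed.

Definition symmetric_rgd : rgdSystem (symmetric_system m) :=
  RGDSystem cox_root_group_subgroup rgd0_root_group rgd1_root_group
    rgd2_root_group rgd3_root_group rgd4_root_group.

(** * Bounds on the lower central series and the value of ndeg *)

Lemma lower_central_unitriangular (H : set G) (c : nat) : H `<=` unitriangular 0 ->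
  lower_central H c `<=` unitriangular c.
Proof.
move=> H0; elim: c => [|c IH]; first exact: H0.
apply: (comm_subgroup_min (unitriangular_subgroup _)) => x y /IH xc /H0 y0.
by have := commg_unitriangular xc y0; rewrite addn0.
Qed.

Lemma X_lower_central (H : set G) (c : nat) a b :
  (forall a' b', (a' < b')%N -> H (X a' b')) -> (a + c < b)%N ->
  lower_central H c (X a b).
Proof.
move=> HX; elim: c b => [|c IH] b ab; first by apply: HX; rewrite -[val a]addn0.
have km : (a + c.+1 < m.+1)%N by apply: ltn_trans ab (ltn_ord b).
(* The index [a + c + 1] is the first for which [X a k] is in the preceding term; its commutator
   with [X k b] is [X a b]. *)
pose k : I := Ordinal km.
have ak : a != k by rewrite -val_eqE /=; lia.
have kb : k != b by rewrite -val_eqE /=; lia.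
have ab' : a != b by rewrite -val_eqE /=; lia.
rewrite -(commgX ak kb ab'); apply: mem_comm_subgroup.
  by apply: IH; rewrite /=; lia.
by apply: HX => /=; lia.
Qed.

Lemma ndeg_symmetric_rgd : ndeg symmetric_rgd = (m%:Z%:E)%E.
Proof.
have Uw0 w : @rgd_Uw _ symmetric_rgd w `<=` unitriangular 0.
  apply: gen_subgroup_min; first exact: unitriangular_subgroup.
  by move=> g [alpha [/pos_root_group + _]]; apply.
have Uwm w : lower_central (@rgd_Uw _ symmetric_rgd w) m = [set 1].
  apply/seteqP; split.
    by rewrite -unitriangular_max; apply: lower_central_unitriangular.
  move=> _ ->; have [] // := @lower_central_subgroup _ (@rgd_Uw _ symmetric_rgd w) m.
  exact: gen_subgroupP.
apply: supremum_eq; last first.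
  by move=> _ [w _ <-]; apply: nilpotency_class_le.
(* The reversal lies in no positive root, so all [X a b] with [a < b] are available, and the corner
   element [X ord0 ord_max] survives in every term of index below [m]. *)
exists (perm (@rev_ord_inj m.+1) : {perm I}) => //.
apply: nilpotency_class_eq => // c cm e.
have m0 : (0 < m)%N by apply: leq_ltn_trans cm.
have om : (ord0 : I) != ord_max by rewrite -val_eqE /= neq_ltn m0.
apply: (X_neq1 om).
suff : lower_central (@rgd_Uw _ symmetric_rgd (perm (@rev_ord_inj m.+1))) c (X ord0 ord_max).
  by rewrite e.
apply: X_lower_central; last by rewrite add0n.
move=> a b ab; apply: sub_gen_subgroup; exists (perm_root a b); last first.
  by apply: X_root_group; rewrite neq_ltn ab.
split; first exact: pos_roots_root.
by rewrite /perm_root /= !permE /=; have := ltn_ord b; lia.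
Qed.

End Transvections.

Theorem theorem2 : forall n : nat, (3 <= n)%N ->
  exists (C : coxeterSystem) (D : rgdSystem C), ndeg D = ((n%:Z - 1)%R%:E)%E.
Proof.
(* Writing n = m + 1, matrices of size n give the value m = n - 1. *)
case=> [//|m] _.
have [G [X [mx [mx1 mxM mx_inj mxX X_gen]]]] := elementary_group m.
exists (symmetric_system m), (symmetric_rgd mx1 mxM mx_inj mxX X_gen).
by rewrite ndeg_symmetric_rgd -addn1 PoszD addrK.
Qed.
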